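(* For every $\varepsilon>0$ there exists $n_0$ such that the following holds for all $n\ge n_0$. Let $M$ be a matroid of rank $n$, let $f=\lfloor (1-\varepsilon)n/2\rfloor$, and for each $1\le i\le f$ and $1\le j\le n$ let $B_{i,j}$ be a basis of $M$. Then there exist a set $L\subseteq\{1,\dots,f\}$ with $|L|\ge(1/2-\varepsilon)n$ and representatives $b_{i,j}\in B_{i,j}$ for $i\in L$, $1\le j\le n$, such that: (i) for each $i\in L$, the set $\{b_{i,1},\dots,b_{i,n}\}$ is a basis of $M$; (ii) for each $1\le j\le n$, the set $\{b_{i,j}: i\in L\}$ is independent in $M$.
   Context: A (finite) matroid $M=(E,\mathcal I)$ consists of a finite ground set $E$ and a family $\mathcal I$ of ''independent'' subsets of $E$ satisfying: $\emptyset\in\mathcal I$; subsets of independent sets are independent; and if $A,B\in\mathcal I$ with $|A|>|B|$ there is $a\in A\setminus B$ with $B\cup\{a\}\in\mathcal I$. A basis is a maximal independent set; all bases have the same size, the rank of $M$. *)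

(* Defs.v *)
From Stdlib Require Import Reals.
From mathcomp Require Import all_boot.
Set Implicit Arguments. Unset Strict Implicit. Unset Printing Implicit Defensive.

Definition is_matroid (T : finType) (indep : {set T} -> bool) : Prop :=
  [/\ indep set0,
      (forall A B : {set T}, B \subset A -> indep A -> indep B) &
      (forall A B : {set T}, indep A -> indep B -> #|B| < #|A| ->
         exists2 a, a \in A :\: B & indep (a |: B))].

Definition is_basis (T : finType) (indep : {set T} -> bool) (B : {set T}) : Prop :=
  indep B /\ (forall A : {set T}, B \subset A -> indep A -> A = B).

Definition mrank (T : finType) (indep : {set T} -> bool) : nat :=
  \max_(A : {set T} | indep A) #|A|.

(* f = floor((1 - eps) n / 2), as a natural number (0 if negative). *)
Definition fbound (eps : R) (n : nat) : nat :=
  Z.to_nat (Int_part (Rdiv (Rmult (Rminus (IZR 1) eps) (INR n)) (IZR 2))).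

(* Main.v *)
(* Work in the parallel extension of the matroid, so that an array of
   representatives is a set of cells whose rows and columns are independent.
   Take a partial array with the most cells and, among those, with the deficits
   (numbers of empty cells) of the rows concentrated as much as possible.

   If the cell [(k, p)] is empty, the at least [n - f] elements [y] of [B k p]
   outside the span of column [p] lie in the span of row [k]; their circuits
   cover at least [n - f] cells [w] of row [k]. Trading such a [w] for [y] leaves
   the span of row [k] unchanged, so any [z] in the basis at the cell of [w]
   outside that span can be put there, provided an element [v] in its circuit
   in the column is dropped from another row. A row of deficit [d] can thus
   claim [d (n - f)] cells of other rows; since [n - f > f], some row holds more
   than [d] of them.

   Iterating, the claimable part [X] of a row gives a larger claimable part of
   a new row, by a factor [1 + 1/c], as long as few rows have been visited
   compared to [|X|]. Hence a row of which a single deficient row can claim a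
   large constant number of cells leads to a contradiction. Otherwise, if many
   rows have the same deficit [d], the claims are spread enough that some row
   can donate [d + 1] cells to [d + 1] distinct such rows, which contradicts the
   concentration of the deficits. So all but boundedly many rows are full. *)

From mathcomp Require Import zify.
Require Import Defs.
From Stdlib Require Import Reals Lra.
From mathcomp Require Import all_boot.
Set Implicit Arguments. Unset Strict Implicit. Unset Printing Implicit Defensive.

(** * Matroids *)

Section Matroid.

Variables (E : finType) (indep : {set E} -> bool).
Hypothesis matroidE : is_matroid indep.

Implicit Types (A B I J K X Z : {set E}) (v w x y z : E).

(** For independent [A] this says that [z] lies outside the span of [A]; spans enter only through
    this predicate. *)
Definition ext A z := (z \notin A) && indep (z |: A).

Lemma indepS A B : A \subset B -> indep B -> indep A.
Proof. by case: matroidE => _ sub _; apply: sub. Qed.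

Lemma ext_sub A B z : A \subset B -> ext B z -> ext A z.
Proof.
move=> sAB /andP[zB iB]; rewrite /ext (contra (subsetP sAB z) zB) /=.
exact: indepS (setUS _ sAB) iB.
Qed.

Lemma spanned_card I J :
  indep I -> indep J -> {in J, forall z, ~~ ext I z} -> #|J| <= #|I|.
Proof.
move=> iI iJ JI; rewrite leqNgt; apply/negP => ltIJ.
case: matroidE => _ _ /(_ J I iJ iI ltIJ)[a].
rewrite inE => /andP[aI aJ] iaI.
by move: (JI a aJ); rewrite /ext aI iaI.
Qed.

Lemma indep_extend I J :
  indep I -> indep J -> #|I| <= #|J| ->
  exists K, [/\ I \subset K, K \subset I :|: J, indep K & #|K| = #|J|].
Proof.
move=> + iJ; move Dk: (#|J| - #|I|) => k.
elim: k I Dk => [|k IHk] I Dk iI leIJ.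
  by exists I; split=> //; [exact: subsetUl | lia].
case: matroidE => _ _ /(_ J I iJ iI); case; first by lia.
move=> a; rewrite inE => /andP[aI aJ] iaI.
have caI : #|a |: I| = #|I|.+1 by rewrite cardsU1 aI.
case: (IHk (a |: I)) => [||| K [sK Ks iK cK]]; rewrite ?caI //;
  try by move: Dk; clear; lia.
exists K; split=> //; first by apply: subset_trans sK; exact: subsetUr.
apply: (subset_trans Ks); apply/subsetP => x; rewrite !inE.
by case/orP=> [/orP[/eqP->|->]|->]; rewrite ?aJ ?orbT.
Qed.

(** For [z] outside [I], the set of these [x] is the circuit of [z] in [I], without [z]. Were it
    independent together with [z], extending it inside [I] would make [I - x + z] independent for
    some [x] outside the set, against its definition. *)
Lemma circuit_spans I z :
  indep I -> ~~ ext I z -> ~~ ext [set x in I | ext (I :\ x) z] z.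
Proof.
move=> iI nIz; set C := [set x in I | _].
have sCI : C \subset I by apply/subsetP => x; rewrite inE => /andP[].
apply/negP => /andP[zC izC].
have zI : z \notin I.
  apply: contra zC => zI; rewrite inE zI /ext setD11 setD1K //=.
have ltCI : #|C| < #|I|.
  rewrite ltnNge; apply/negP => leIC.
  have/eqP eCI : C == I by rewrite eqEcard sCI leIC.
  by move: nIz; rewrite -eCI /ext zC izC.
have [|K [sK Ks iK cK]] := indep_extend izC iI; first by rewrite cardsU1 zC.
have zK : z \in K by apply: (subsetP sK); rewrite setU11.
have sKI : K :\ z \subset I.
  apply/subsetP => x; rewrite !inE => /andP[xz xK].
  move/subsetP: Ks => /(_ x xK); rewrite !inE (negPf xz) /=.
  by case/orP=> // /andP[].
have : ~~ (I \subset K :\ z).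
  by apply/negP => /subset_leq_card; rewrite -cK (cardsD1 z K) zK; clear; lia.
case/subsetPn => x xI xK.
have xC : x \notin C.
  apply: contra xK => xC.
  have xK : x \in K by apply: (subsetP sK); rewrite in_setU1 xC orbT.
  by rewrite in_setD1 xK andbT; apply: contraNneq zI => <-.
move: xC; rewrite inE xI /= /ext !inE (negPf zI) andbF /= => /negP; apply.
apply: indepS iK; apply/subsetP => u; rewrite !inE.
case/orP=> [/eqP-> //|/andP[ux uI]].
have/eqP eK : K :\ z == I :\ x.
  rewrite eqEcard; apply/andP; split; last first.
    by move: (cardsD1 z K) (cardsD1 x I) cK; rewrite zK xI; clear; lia.
  apply/subsetP => t tK; rewrite !inE (subsetP sKI) // andbT.
  by apply: contraNneq xK => <-.
by have : u \in K :\ z; [rewrite eK !inE ux uI | rewrite !inE => /andP[]].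
Qed.

(** The circuit of [z] in [I] avoids [X], so it survives the removal of [X]; the element [v] of [X]
    shows that [I] spans [z] at all. *)
Lemma not_ext_setD I X z v :
  indep I -> v \in X -> {in X, forall x, ~~ ext (I :\ x) z} ->
  ~~ ext (I :\: X) z.
Proof.
move=> iI vX nX.
have nI : ~~ ext I z by apply: contra (nX v vX); apply: ext_sub (subD1set _ _).
apply: contra (circuit_spans iI nI); apply: ext_sub.
apply/subsetP => x; rewrite !inE => /andP[xI ex]; rewrite xI andbT.
by apply/negP => xX; move: (nX x xX); rewrite ex.
Qed.

(** The union of the circuits still spans the independent set [Z], so [spanned_card] applies. *)
Lemma circuits_card I Z :
  indep I -> indep Z -> {in Z, forall z, ~~ ext I z} ->
  #|Z| <= #|[set x in I | [exists z in Z, ext (I :\ x) z]]|.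
Proof.
move=> iI iZ nZ; set C := [set x in I | _].
have sCI : C \subset I by apply/subsetP => x; rewrite inE => /andP[].
apply: spanned_card (indepS sCI iI) iZ _ => z zZ.
apply: contra (circuit_spans iI (nZ z zZ)); apply: ext_sub.
apply/subsetP => x; rewrite !inE => /andP[-> ex] /=.
by apply/existsP; exists z; rewrite zZ ex.
Qed.

Lemma card_ext I B :
  indep I -> indep B -> #|B| - #|I| <= #|[set z in B | ext I z]|.
Proof.
move=> iI iB.
have -> : [set z in B | ext I z] = B :&: [set z | ext I z].
  by apply/setP => z; rewrite !inE.
have : #|B :\: [set z | ext I z]| <= #|I|.
  apply: spanned_card iI (indepS (subsetDl _ _) iB) _ => z.
  by rewrite !inE => /andP[].
by have := cardsID [set z | ext I z] B; clear; lia.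
Qed.

(* Exchanging [w] for [y] does not change the span of [I]. *)
Lemma ext_exchange I w y z :
  indep I -> w \in I -> ~~ ext I y -> ext (I :\ w) y -> ext I z ->
  ext (y |: (I :\ w)) z.
Proof.
move=> iI wI nIy /andP[ywI iyI] /andP[zI izI].
set I' := y |: (I :\ w).
have ltI : #|I'| < #|z |: I|.
  by rewrite /I' !cardsU1 ywI zI; have := cardsD1 w I; rewrite wI; clear; lia.
case: matroidE => _ _ /(_ _ _ izI iyI ltI)[a].
rewrite in_setD => /andP[aI'].
rewrite in_setU1 => /orP[/eqP az|aI] iaI.
  by rewrite /ext -az aI' iaI.
have aw : a = w.
  apply/eqP; apply: contraR aI' => aw; by rewrite !inE aw aI orbT.
case: (eqVneq y w) => [yw|yw].
  by move: aI'; rewrite aw /I' yw setU11.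
move: ywI; rewrite in_setD1 yw /= => yI.
move: nIy iaI; rewrite aw /ext yI /= /I' => /negP nIy.
by rewrite setUCA setD1K.
Qed.

End Matroid.

(** * Counting *)

Lemma sum_card_fibres (E K : finType) (h : E -> K) (A : {set E}) :
  \sum_i #|[set e in A | h e == i]| = #|A|.
Proof.
rewrite -sum1_card (partition_big h predT) //=; apply: eq_bigr => i _.
by rewrite -sum1_card; apply: eq_bigl => e; rewrite inE.
Qed.

Lemma sum_card_fibres_inj (E K : finType) (h : E -> K) (A D : {set E}) :
  {in D &, injective h} ->
  \sum_(w in D) #|[set u in A | h u == h w]| <= #|A|.
Proof.
move=> injD; rewrite -(big_imset (fun i => #|[set u in A | h u == i]|) injD) /=.
rewrite -[leqRHS](sum_card_fibres h) [leqRHS](bigID (mem (h @: D))) /=.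
exact: leq_addr.
Qed.

Lemma fibre_pigeonhole (E K : finType) (h : E -> K) (A : {set E}) :
  0 < #|A| -> exists i, #|A| <= #|K| * #|[set e in A | h e == i]|.
Proof.
move=> A_gt0; case: (boolP [exists i, #|A| <= #|K| * #|[set e in A | h e == i]|]).
  by case/existsP=> i; exists i.
rewrite negb_exists => /forallP noi; exfalso.
have: \sum_i #|K| * #|[set e in A | h e == i]| <= \sum_(i : K) #|A|.-1.
  by apply: leq_sum => i _; have := noi i; rewrite -ltnNge; clear -A_gt0; lia.
rewrite -big_distrr /= sum_card_fibres sum_nat_const.
have [e _] := card_gt0P A_gt0.
have K_gt0 : 0 < #|K| by apply/card_gt0P; exists (h e).
by rewrite leq_pmul2l //; move: A_gt0; clear; lia.
Qed.

(** The second hypothesis is the integer form of [n - 2 f >= n / c], where [1 / c] plays the part of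
    epsilon. *)
Lemma double_le_of_gap c f n : 0 < c -> c * f + n <= c * (n - f) -> f.*2 <= n.
Proof.
move=> c_gt0 gap.
have : c * f <= c * (n - f) by apply: leq_trans gap; exact: leq_addr.
by rewrite leq_pmul2l //; clear; lia.
Qed.

(* Each step of a cascade gains [16 c], so [|X|] exceeds [n] after at most
   [n / (8 c)] steps, before the [2 l] modified columns matter. *)
Lemma cascade_growth c f n l x x' :
  0 < c -> c * f + n <= c * (n - f) -> 0 < f ->
  16 * c * c <= x -> 16 * c * l <= x -> 8 * c * l <= n ->
  l * n < x * (n - f - l.*2) /\
  (x * (n - f - l.*2) <= f * x' + l * n -> x + 16 * c <= x').
Proof.
move=> c_gt0 gap f_gt0 x_big x_l l_n; have f2 := double_le_of_gap c_gt0 gap.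
set g := n - f; set y := x * (g - l.*2).
have x_gt0 : 0 < x by move: c_gt0 x_big; clear; nia.
have h1 : 4 * c * y + x * n >= 4 * (x * (c * g)).
  have : x * (8 * c * l) <= x * n by rewrite leq_mul2l l_n orbT.
  have : x * g <= y + x * (l.*2).
    by rewrite /y -mulnDr leq_mul2l; apply/orP; right; clear; lia.
  by clear; nia.
have h2 : x * (c * f) + x * n <= x * (c * g).
  by rewrite -mulnDr leq_mul2l gap orbT.
have h3 : 16 * c * l * n <= x * n by rewrite leq_mul2r x_l orbT.
have h4 : 0 < x * n.
  by rewrite muln_gt0 x_gt0 /=; move: f2 f_gt0; clear; lia.
split.
  rewrite -(ltn_pmul2l (m := 4 * c)); last by rewrite muln_gt0.
  by move: h1 h2 h3 h4; clear; nia.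
move=> h5.
have h6 : x * f.*2 <= x * n by rewrite leq_mul2l f2 orbT.
have h7 : f * (c * x + x) <= f * (c * x').
  rewrite -(leq_pmul2l (m := 4)) //.
  have : 4 * c * y <= 4 * c * (f * x' + l * n) by rewrite leq_mul2l h5 orbT.
  by move: h1 h2 h3 h6; clear; nia.
move: h7; rewrite leq_pmul2l // => h7.
rewrite -(leq_pmul2l (m := c)) // mulnDr.
by move: h7 x_big; clear; nia.
Qed.

(** This serves a pigeonhole, with a factor [d] cancelled: if [m] rows of deficit [d] claim
    [d (n - f - m)] cells each, one of the [f] rows holds more than [d (m + D)] of them. After
    multiplication by [c] the gap leaves [m n] to pay for [m f + c m^2]. *)
Lemma donation_count c f n D m :
  0 < m -> c * f + n <= c * (n - f) -> 0 < c -> m = c * D -> 2 * c * m < n ->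
  f * (m + D) < m * (n - f - m).
Proof.
move=> m_gt0 gap c_gt0 mD n_big; have f2 := double_le_of_gap c_gt0 gap.
rewrite -(ltn_pmul2l c_gt0).
have h1 : m * (c * f + n) <= m * (c * (n - f)) by rewrite leq_mul2l gap orbT.
have h2 : m * (2 * c * m) < m * n by rewrite ltn_pmul2l.
have h3 : m * f.*2 <= m * n by rewrite leq_mul2l f2 orbT.
have h4 : c * (f * (m + D)) = m * (c * f) + m * f by rewrite mD; clear; nia.
have h5 : c * (m * (n - f)) <= c * (m * (n - f - m)) + c * (m * m).
  by rewrite -!mulnDr !leq_mul2l; apply/orP; right; apply/orP; right; clear; lia.
by move: h1 h2 h3 h4 h5; clear; nia.
Qed.

(** * Partial arrays *)

Section Array.

Variables (E I J : finType) (indep : {set E} -> bool).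
Variables (rw : E -> I) (cl : E -> J) (G : {set E}).
Hypothesis matroidE : is_matroid indep.

Local Notation ext := (ext indep).
Local Notation n := #|J|.
Local Notation f := #|I|.

Implicit Types (S W X Z D : {set E}) (U : {set I}) (P : {set J}) (l : nat).
Implicit Types (e u v w x y z : E) (i k : I) (j p q : J).

Definition cell i j := [set e in G | (rw e == i) && (cl e == j)].

Hypothesis cell_indep : forall i j, indep (cell i j).
Hypothesis cell_card : forall i j, #|cell i j| = n.

Definition Row S i := [set e in S | rw e == i].
Definition Col S j := [set e in S | cl e == j].

(** A partial array is the set of its entries, so filling and emptying cells are set operations; the
    last clause allows one entry per cell. *)
Definition valid S :=
  [&& S \subset G, [forall i, indep (Row S i)], [forall j, indep (Col S j)] &
    [forall e in S, forall e' in S,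
       (rw e == rw e') && (cl e == cl e') ==> (e == e')]].

Definition free S k p := {in S, forall e, rw e = k -> cl e <> p}.

Lemma validP S :
  reflect [/\ S \subset G, forall i, indep (Row S i), forall j, indep (Col S j)
            & {in S &, forall e e', rw e = rw e' -> cl e = cl e' -> e = e'}]
          (valid S).
Proof.
apply: (iffP and4P) => [[sG /forallP iR /forallP iC /forallP uS]|[sG iR iC uS]].
  split=> // e e' eS e'S er ec; have /implyP/(_ eS)/forallP/(_ e') := uS e.
  by rewrite e'S er ec !eqxx /= => /eqP.
split=> //; try exact/forallP.
apply/forallP => e; apply/implyP => eS; apply/forallP => e'; apply/implyP => e'S.
by apply/implyP => /andP[/eqP er /eqP ec]; apply/eqP; apply: uS.
Qed.

Lemma RowD1 S w i : Row (S :\ w) i = Row S i :\ w.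
Proof. by apply/setP => e; rewrite !inE andbA. Qed.

Lemma ColD1 S w j : Col (S :\ w) j = Col S j :\ w.
Proof. by apply/setP => e; rewrite !inE andbA. Qed.

Lemma RowU1 S y : Row (y |: S) (rw y) = y |: Row S (rw y).
Proof. by apply/setP => e; rewrite !inE; case: eqP => [->|]; rewrite ?eqxx. Qed.

Lemma ColU1 S y : Col (y |: S) (cl y) = y |: Col S (cl y).
Proof. by apply/setP => e; rewrite !inE; case: eqP => [->|]; rewrite ?eqxx. Qed.

Lemma RowU1_neq S y i : i != rw y -> Row (y |: S) i = Row S i.
Proof.
move=> iy; apply/setP => e; rewrite !inE; case: (eqVneq e y) => //= ->.
by rewrite eq_sym (negPf iy) andbF.
Qed.

Lemma ColU1_neq S y j : j != cl y -> Col (y |: S) j = Col S j.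
Proof.
move=> iy; apply/setP => e; rewrite !inE; case: (eqVneq e y) => //= ->.
by rewrite eq_sym (negPf iy) andbF.
Qed.

Lemma D1_notin S w : w \notin S -> S :\ w = S.
Proof.
move=> wS; apply/setP => e; rewrite !inE.
by case: eqP => //= ->; rewrite (negPf wS).
Qed.

Lemma RowD1_neq S w i : i != rw w -> Row (S :\ w) i = Row S i.
Proof. by move=> iw; rewrite RowD1 D1_notin // inE eq_sym (negPf iw) andbF. Qed.

Lemma ColD1_neq S w j : j != cl w -> Col (S :\ w) j = Col S j.
Proof. by move=> jw; rewrite ColD1 D1_notin // inE eq_sym (negPf jw) andbF. Qed.

Lemma valid_indep_Row S i : valid S -> indep (Row S i).
Proof. by case/validP. Qed.

Lemma valid_indep_Col S j : valid S -> indep (Col S j).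
Proof. by case/validP. Qed.

Lemma valid_subset S S' : S' \subset S -> valid S -> valid S'.
Proof.
move=> sS /validP[sG iR iC uS]; apply/validP; split.
- exact: subset_trans sG.
- by move=> i; apply: indepS (iR i) => //; apply/subsetP => e;
    rewrite !inE => /andP[/(subsetP sS)-> ->].
- by move=> j; apply: indepS (iC j) => //; apply/subsetP => e;
    rewrite !inE => /andP[/(subsetP sS)-> ->].
by move=> e e' /(subsetP sS) eS /(subsetP sS) e'S; apply: uS.
Qed.

Lemma valid_add S y :
  valid S -> y \in G -> free S (rw y) (cl y) ->
  ext (Row S (rw y)) y -> ext (Col S (cl y)) y -> valid (y |: S).
Proof.
move=> /validP[sG iR iC uS] yG fy /andP[_ eR] /andP[_ eC]; apply/validP; split.
- by rewrite subUset sub1set yG.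
- by move=> i; case: (eqVneq i (rw y)) => [->|iy]; rewrite ?RowU1 ?RowU1_neq.
- by move=> j; case: (eqVneq j (cl y)) => [->|jy]; rewrite ?ColU1 ?ColU1_neq.
move=> e e'; rewrite !in_setU1 => /orP[/eqP->|eS] /orP[/eqP->|e'S] //.
- by move=> er ec; case: (fy e' e'S).
- by move=> er ec; case: (fy e eS).
exact: uS.
Qed.

Lemma cl_inj_Row S k : valid S -> {in Row S k &, injective cl}.
Proof.
case/validP=> _ _ _ uS e e'; rewrite !inE => /andP[eS /eqP er] /andP[e'S /eqP er'].
by move=> ec; apply: uS => //; rewrite er er'.
Qed.

Lemma rw_inj_Col S j : valid S -> {in Col S j &, injective rw}.
Proof.
case/validP=> _ _ _ uS e e'; rewrite !inE => /andP[eS /eqP er] /andP[e'S /eqP er'].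
by move=> ec; apply: uS => //; rewrite er er'.
Qed.

Lemma Row_card S k : valid S -> #|Row S k| <= n.
Proof. by move=> vS; rewrite -(card_in_imset (cl_inj_Row (k:=k) vS)) max_card. Qed.

Lemma Col_card S j : valid S -> #|Col S j| <= f.
Proof. by move=> vS; rewrite -(card_in_imset (rw_inj_Col (j:=j) vS)) max_card. Qed.

(** * Arrays of maximum volume, and shifts of a hole along a row *)

Definition maxvol S := valid S /\ forall S', valid S' -> #|S'| <= #|S|.

Lemma maxvol_swap S y w :
  maxvol S -> w \in S -> y \in G -> free (S :\ w) (rw y) (cl y) ->
  ext (Row (S :\ w) (rw y)) y -> ext (Col (S :\ w) (cl y)) y ->
  maxvol (y |: (S :\ w)) /\ #|y |: (S :\ w)| = #|S|.
Proof.
move=> [vS maxS] wS yG fy eR eC.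
have yS : y \notin S :\ w by apply/negP => /fy; case.
have cS : #|y |: (S :\ w)| = #|S| by rewrite cardsU1 yS (cardsD1 w S) wS.
split=> //; split; last by rewrite cS.
by apply: valid_add => //; apply: valid_subset vS; exact: subD1set.
Qed.

Lemma maxvol_not_ext S y :
  maxvol S -> y \in G -> free S (rw y) (cl y) ->
  ext (Col S (cl y)) y -> ~~ ext (Row S (rw y)) y.
Proof.
move=> [vS maxS] yG fy eC; apply/negP => eR.
have := maxS _ (valid_add vS yG fy eR eC).
have yS : y \notin S by apply/negP => /fy; case.
by rewrite cardsU1 yS ltnn.
Qed.

(** Here [w] is on the circuit of [y] in row [k], so trading [w] for [y] moves the hole of the row
    from column [p] to that of [w]. *)
Definition shiftable S k p y w :=
  [/\ y \in G, rw y = k, cl y = p &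
   [/\ ~~ ext (Row S k) y, ext (Row S k :\ w) y & ext (Col S p) y]].

(** A column has at most [f] entries, so at least [n - f] elements of the cell extend it. By
    maximality row [k] spans them, and their circuits cover as many entries. *)
Lemma shiftable_many S k p : maxvol S -> free S k p ->
  exists W, [/\ W \subset Row S k, n - f <= #|W| &
             {in W, forall w, exists y, shiftable S k p y w}].
Proof.
move=> mS fS; have vS := mS.1.
set Y := [set y in cell k p | ext (Col S p) y].
have YP y : y \in Y -> [/\ y \in G, rw y = k, cl y = p & ext (Col S p) y].
  by rewrite !inE => /andP[/andP[-> /andP[/eqP-> /eqP->]] ->].
have cY : n - f <= #|Y|.
  have := card_ext matroidE (valid_indep_Col p vS) (cell_indep k p).
  by rewrite cell_card -/Y; move: (Col_card p vS); clear; lia.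
have nY : {in Y, forall y, ~~ ext (Row S k) y}.
  move=> y /YP[yG yk yp eC]; rewrite -yk; apply: maxvol_not_ext => //.
    by rewrite yk yp.
  by rewrite yp.
exists [set w in Row S k | [exists y in Y, ext (Row S k :\ w) y]]; split.
- by apply/subsetP => w; rewrite inE => /andP[].
- apply: leq_trans cY _; apply: circuits_card => //.
    exact: valid_indep_Row.
  by apply: indepS (cell_indep k p) => //; apply/subsetP => y; rewrite inE => /andP[].
move=> w; rewrite inE => /andP[_ /existsP[y /andP[yY eW]]]; exists y.
by have [yG yk yp eC] := YP y yY; split=> //; split=> //; apply: nY.
Qed.

Lemma shift_maxvol S k p y w :
  maxvol S -> free S k p -> w \in Row S k -> shiftable S k p y w ->
  maxvol (y |: (S :\ w)) /\ #|y |: (S :\ w)| = #|S|.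
Proof.
move=> mS fS; rewrite inE => /andP[wS /eqP wk] [yG yk yp [_ eR eC]].
apply: maxvol_swap => //.
- by rewrite yk yp => e; rewrite inE => /andP[_]; apply: fS.
- by rewrite yk RowD1.
rewrite yp ColD1_neq //; apply/eqP => pw.
by case: (fS w wS).
Qed.

(* [transfer S y w z v] fills the empty cell of [y], replaces [w] by [z] in its
   cell and drops [v], which lies in the column of [z]. *)
Definition transfer S y w z v := z |: ((y |: (S :\ w)) :\ v).

(** The conditions on [S] concern only the row of [w] and the columns of [y] and [w], so they pass
    to any array that agrees on these three lines. *)
Definition movable S y w z v :=
  [/\ [/\ y \in G, z \in G, w \in S & v \in S],
      [/\ rw y = rw w, rw z = rw w, cl z = cl w, cl v = cl w & rw v != rw w],
      free S (rw w) (cl y) &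
   [/\ ext (Row S (rw w) :\ w) y, ext (y |: (Row S (rw w) :\ w)) z,
       ext (Col S (cl y)) y & ext (Col S (cl w) :\ w :\ v) z]].

Lemma movable_local S S' y w z v :
  Row S (rw w) = Row S' (rw w) -> Col S (cl y) = Col S' (cl y) ->
  Col S (cl w) = Col S' (cl w) -> movable S y w z v -> movable S' y w z v.
Proof.
move=> eR eCy eCw [[yG zG wS vS] [yw zw cz cv nv] fS [e1 e2 e3 e4]].
have wS' : w \in Row S' (rw w) by rewrite -eR inE wS eqxx.
have vS' : v \in Col S' (cl w) by rewrite -eCw inE vS cv eqxx.
move: wS' vS'; rewrite !inE => /andP[wS' _] /andP[vS' _].
split=> //; last by rewrite -eR -eCy -eCw.
move=> e eS er; have: e \in Row S' (rw w) by rewrite inE eS er eqxx.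
by rewrite -eR inE => /andP[eS' _]; apply: fS.
Qed.

(** * The effect of a transfer on rows and columns *)

Section Transfer.

Variables (S : {set E}) (y w z v : E).
Hypothesis mv : movable S y w z v.

Lemma transfer_cl_neq : cl y != cl w.
Proof. by case: mv => [[_ _ wS _] _ fS _]; apply/eqP => /esym; apply: fS. Qed.

Lemma transfer_maxvol :
  maxvol S -> maxvol (transfer S y w z v) /\ #|transfer S y w z v| = #|S|.
Proof.
move=> mS; case: mv => [[yG zG wS vS] [yw zw cz cv nv] fS [e1 e2 e3 e4]].
have cyw := transfer_cl_neq; have uS := mS.1; case/validP: uS => _ _ _ uS.
have [|||||mS1 cS1] := @maxvol_swap S y w mS => //.
- by rewrite yw => e; rewrite inE => /andP[_]; apply: fS.
- by rewrite yw RowD1.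
- by rewrite ColD1_neq.
have vw : v != w by apply: contraNneq nv => ->.
rewrite /transfer -cS1; apply: maxvol_swap => //.
- by rewrite !inE vw vS orbT.
- move=> e; rewrite !inE => /andP[ev /orP[/eqP->|/andP[ew eS]]].
    by rewrite cz => _; apply/eqP.
  by rewrite zw cz => er ec; case/eqP: ew; apply: uS.
- rewrite RowD1_neq; last by rewrite zw eq_sym.
  by rewrite zw -yw RowU1 RowD1 yw.
by rewrite cz ColD1 ColU1_neq 1?eq_sym // ColD1.
Qed.

Lemma transfer_Row i : i != rw w -> Row (transfer S y w z v) i = Row S i :\ v.
Proof.
case: mv => [_ [yw zw _ _ _] _ _] iw.
by rewrite /transfer RowU1_neq ?zw // RowD1 RowU1_neq ?yw // RowD1_neq.
Qed.

Lemma transfer_Row_neq i :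
  i != rw w -> i != rw v -> Row (transfer S y w z v) i = Row S i.
Proof.
move=> iw iv; rewrite transfer_Row // D1_notin // inE eq_sym (negPf iv).
by rewrite andbF.
Qed.

Lemma transfer_Row_card :
  #|Row (transfer S y w z v) (rw w)| = #|Row S (rw w)|.+1.
Proof.
case: mv => [[yG zG wS vS] [yw zw cz cv nv] fS [/andP[e1 _] /andP[e2 _] _ _]].
have -> : Row (transfer S y w z v) (rw w) = z |: (y |: (Row S (rw w) :\ w)).
  rewrite /transfer -zw RowU1 zw RowD1_neq 1?eq_sym //.
  by rewrite -yw RowU1 yw RowD1.
rewrite !cardsU1 e1 e2.
by rewrite (cardsD1 w (Row S (rw w))) inE wS eqxx.
Qed.

Lemma transfer_Col j :
  j != cl y -> j != cl w -> Col (transfer S y w z v) j = Col S j.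
Proof.
case: mv => [_ [_ _ cz cv _] _ _] jy jw.
by rewrite /transfer ColU1_neq ?cz // ColD1_neq ?cv // ColU1_neq // ColD1_neq.
Qed.

End Transfer.

(** * Elements that a row accepts after a shift *)

Section Shift.

Variables (S : {set E}) (k : I) (p : J) (y w z : E).
Hypotheses (mS : maxvol S) (fS : free S k p).
Hypotheses (wR : w \in Row S k) (sh : shiftable S k p y w).
Hypotheses (zB : z \in cell k (cl w)) (zR : ext (Row S k) z).

Lemma shift_ext : ext (y |: (Row S k :\ w)) z.
Proof.
case: sh => [_ _ _ [nR eR _]].
exact: ext_exchange (valid_indep_Row k mS.1) wR nR eR zR.
Qed.

(** After [w] is traded for [y], the cell of [z] is empty and the row still accepts [z]; by
    maximality the column must refuse it. *)
Lemma shift_blocked : ~~ ext (Col S (cl w) :\ w) z.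
Proof.
have [mS1 _] := shift_maxvol mS fS wR sh.
move: wR zB; rewrite !inE => /andP[wS /eqP wk] /andP[zG /andP[/eqP zk /eqP zc]].
case: sh => [yG yk yp _].
have pw : cl w != p by apply/eqP; apply: fS.
apply: contraL shift_ext => eC.
have := @maxvol_not_ext _ z mS1 zG.
rewrite zk -yk RowU1 RowD1 yk zc; apply; last first.
  by rewrite ColU1_neq ?yp // ColD1.
move=> e; rewrite !inE => /orP[/eqP->|/andP[ew eS]].
  by rewrite yp => _ /eqP; rewrite eq_sym (negPf pw).
case/validP: mS.1 => _ _ _ uS er ec; case/eqP: ew; apply: uS => //.
by rewrite er wk.
Qed.

Lemma shift_movable v :
  v \in Col S (cl w) -> v != w -> ext (Col S (cl w) :\ w :\ v) z ->
  movable S y w z v.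
Proof.
rewrite inE => /andP[vS /eqP vc] vw eC.
have := shift_ext.
move: wR zB; rewrite !inE => /andP[wS /eqP wk] /andP[zG /andP[/eqP zk /eqP zc]].
case: sh => [yG yk yp [_ e1 e2]] e3.
split; rewrite ?wk ?yp //; split=> //.
case/validP: mS.1 => _ _ _ uS; apply: contraNneq vw => vk.
by apply/eqP; apply: uS => //; rewrite vk wk.
Qed.

End Shift.

(** In the column of [w] the circuits of [Z w] cover at least [#|Z w|] entries, all in distinct
    rows, so at most [#|U|] of them fall in [U]. Distinct [w] of row [k] have distinct columns, so
    the counts add up. *)
Lemma spread S k D (Z : E -> {set E}) U :
  valid S -> D \subset Row S k ->
  {in D, forall w, indep (Z w)} ->
  {in D, forall w, {in Z w, forall z, ~~ ext (Col S (cl w) :\ w) z}} ->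
  \sum_(w in D) (#|Z w| - #|U|) <=
  #|[set u in S | (rw u \notin U) && [exists w in D,
      [&& cl u == cl w, u != w &
          [exists z in Z w, ext (Col S (cl w) :\ w :\ u) z]]]]|.
Proof.
move=> vS sD iZ nZ; set A := [set u in S | _].
have injD : {in D &, injective cl}.
  by move=> e e' /(subsetP sD) eD /(subsetP sD) e'D; apply: cl_inj_Row vS _ _ eD e'D.
apply: leq_trans (sum_card_fibres_inj A injD); apply: leq_sum => w wD.
set C := Col S (cl w) :\ w.
have iC : indep C.
  by apply: indepS (valid_indep_Col (cl w) vS) => //; exact: subD1set.
have := circuits_card matroidE iC (iZ w wD) (nZ w wD).
set V := [set x in C | _].
have sV : V \subset Col S (cl w).
  by apply/subsetP => x /setIdP[/setD1P[]].
have le1 : #|V :&: [set u | rw u \in U]| <= #|U|.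
  have injV : {in V :&: [set u | rw u \in U] &, injective rw}.
    move=> e e'; rewrite !(in_setI _ V) => /andP[/(subsetP sV) eV _].
    by case/andP=> /(subsetP sV) e'V _; apply: rw_inj_Col vS _ _ eV e'V.
  rewrite -(card_in_imset injV); apply: subset_leq_card.
  by apply/subsetP => i /imsetP[u]; rewrite !inE => /andP[_ ru] ->.
have le2 : #|V :\: [set u | rw u \in U]| <= #|[set u in A | cl u == cl w]|.
  apply: subset_leq_card; apply/subsetP => u; rewrite in_setD inE => /andP[uU uV].
  have /setIdP[uS uc] := subsetP sV u uV.
  rewrite inE uc andbT inE uS uU /=; apply/existsP; exists w; rewrite wD uc /=.
  by have /setIdP[/setD1P[-> _] ->] := uV.
have := cardsID [set u | rw u \in U] V.
by move: le1 le2; clear; lia.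
Qed.

(* A chain of transfers through the rows [U] frees [v] in row [k], leaving the
   other rows untouched and modifying at most [2 l] columns. *)
Definition freeing S S' U P k l v :=
  [/\ maxvol S', #|P| <= l.*2, Row S' k = Row S k :\ v,
      (forall r, r \notin U -> r != k -> Row S' r = Row S r) &
      (forall j, j \notin P -> Col S' j = Col S j)].

Definition freeable S U k l v := exists S' P, freeing S S' U P k l v.

Lemma freeing_free S S' U P k l v :
  valid S -> v \in Row S k -> freeing S S' U P k l v -> free S' k (cl v).
Proof.
move=> vS vR [_ _ eR _ _] e eS ek ec.
have : e \in Row S' k by rewrite inE eS ek eqxx.
rewrite eR => /setD1P[ev eR']; case/eqP: ev.
exact: cl_inj_Row vS _ _ eR' vR ec.
Qed.

Lemma card_avoid_cols S k P W :
  valid S -> W \subset Row S k ->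
  #|W| - #|P| <= #|W :\: [set w | cl w \in P]|.
Proof.
move=> vS sW; have := cardsID [set w | cl w \in P] W.
suff : #|W :&: [set w | cl w \in P]| <= #|P| by clear; lia.
have injW : {in W :&: [set w | cl w \in P] &, injective cl}.
  move=> e e' /setIP[/(subsetP sW) eW _] /setIP[/(subsetP sW) e'W _].
  exact: cl_inj_Row vS _ _ eW e'W.
rewrite -(card_in_imset injW); apply: subset_leq_card.
by apply/subsetP => j /imsetP[u]; rewrite !inE => /andP[_ ru] ->.
Qed.

(** Only shifts towards unmodified columns are kept, at a loss of [2 l], so that circuits in these
    columns are those of [S], whichever [v] is freed. *)
Lemma freeing_shifts S U k l v :
  valid S -> v \in Row S k -> freeable S U k l v ->
  exists W, [/\ W \subset Row S k, n - f - l.*2 <= #|W| &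
    {in W, forall w, exists S' P y,
      [/\ freeing S S' U P k l v, shiftable S' k (cl v) y w,
          w \in Row S' k & cl w \notin P]}].
Proof.
move=> vS vR [S' [P fr]]; have [mS' cP eR _ _] := fr.
have [W [sW cW hW]] := shiftable_many mS' (freeing_free vS vR fr).
exists (W :\: [set w | cl w \in P]); split.
- apply: subset_trans (subsetDl _ _) _; apply: (subset_trans sW).
  by rewrite eR subD1set.
- by have := card_avoid_cols P mS'.1 sW; move: cW cP; clear; lia.
move=> w /setDP[wW]; rewrite inE => wP; have [y sh] := hW w wW.
by exists S', P, y; split=> //; apply: (subsetP sW).
Qed.

(** Each [v] of [X], once freed, opens at least [n - f - 2 l] cells of row [k]. A cell opened by
    several [v] accepts at least as many elements [z], whose circuits reach as many entries of the
    column. Avoiding [U] costs at most [l] per column, and one of the [f] rows gets an average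
    share. *)
Lemma cascade_step S U k l X :
  valid S -> k \notin U -> #|U| <= l -> X \subset Row S k ->
  {in X, forall v, freeable S U k l v} ->
  l * n < #|X| * (n - f - l.*2) ->
  exists r X', [/\ r \notin k |: U, X' \subset Row S r,
    #|X| * (n - f - l.*2) <= f * #|X'| + l * n &
    {in X', forall v, freeable S (k |: U) r l.+1 v}].
Proof.
move=> vS kU cU sX frX big.
have ex_W v : exists W : {set E}, v \in X ->
  [/\ W \subset Row S k, n - f - l.*2 <= #|W| &
    {in W, forall w, exists S' P y,
      [/\ freeing S S' U P k l v, shiftable S' k (cl v) y w,
          w \in Row S' k & cl w \notin P]}].
  case: (boolP (v \in X)) => [vX|_]; last by exists set0.
  by have [W HW] := freeing_shifts vS (subsetP sX v vX) (frX v vX); exists W.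
have [W hW] := fin_all_exists ex_W.
pose Xw w := [set v in X | w \in W v].
pose Z w := [set z in cell k (cl w) |
  [exists v in X, (w \in W v) && ext (Row S k :\ v) z]].
have iR := valid_indep_Row k vS.
have iZ w : indep (Z w).
  apply: indepS (cell_indep k (cl w)) => //.
  by apply/subsetP => z; rewrite inE => /andP[].
have cZ w : #|Xw w| <= #|Z w|.
  case: (set_0Vmem (Xw w)) => [->|[v0 v0X]]; first by rewrite cards0.
  have sXw : Xw w \subset Row S k.
    by apply/subsetP => v /setIdP[/(subsetP sX)].
  (* The elements of the cell outside [Z w] are spanned by row [k] even without all of [Xw w], hence
     are few. *)
  have : #|cell k (cl w) :\: Z w| <= #|Row S k :\: Xw w|.
    apply: (spanned_card matroidE).
    - by apply: indepS iR => //; exact: subsetDl.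
    - by apply: indepS (cell_indep k (cl w)) => //; exact: subsetDl.
    move=> z /setDP[zB zZ]; apply: (not_ext_setD matroidE iR v0X) => v vXw.
    apply: contra zZ => ez; apply/setIdP; split=> //.
    by apply/existsP; exists v; have /setIdP[-> ->] := vXw.
  have := cardsID (Z w) (cell k (cl w)); have := cardsID (Xw w) (Row S k).
  rewrite cell_card (setIidPr sXw).
  have := subset_leq_card (subsetIr (cell k (cl w)) (Z w)).
  by have := Row_card k vS; clear; lia.
have nZ : {in Row S k, forall w, {in Z w, forall z, ~~ ext (Col S (cl w) :\ w) z}}.
  move=> w wR z /setIdP[zB /existsP[v /and3P[vX wW ez]]].
  have [_ _ /(_ w wW)[S' [P [y [fr sh wR' wP]]]]] := hW v vX.
  have [mS' _ eR _ eC] := fr.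
  have := shift_blocked mS' (freeing_free vS (subsetP sX v vX) fr) wR' sh zB.
  by rewrite eC // eR; apply.
have := spread U vS (subxx _) (fun w _ => iZ w) nZ; set A := [set u in S | _] => leA.
have sumX : #|X| * (n - f - l.*2) <= \sum_(w in Row S k) #|Xw w|.
  have -> : \sum_(w in Row S k) #|Xw w| = \sum_(v in X) #|W v|.
    transitivity (\sum_(w in Row S k) \sum_(v in X) (w \in W v : nat)).
      apply: eq_bigr => w _; rewrite -sum1_card big_mkcond [RHS]big_mkcond /=.
      by apply: eq_bigr => v _; rewrite inE; case: (v \in X); case: (w \in W v).
    rewrite exchange_big /=; apply: eq_bigr => v vX.
    have [sW _ _] := hW v vX.
    rewrite -sum1_card big_mkcond [RHS]big_mkcond /=; apply: eq_bigr => w _.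
    by case: (boolP (w \in W v)) => [/(subsetP sW)->|]; last case: ifP.
  rewrite -sum_nat_const; apply: leq_sum => v vX; by have [] := hW v vX.
have cA : #|X| * (n - f - l.*2) <= #|A| + l * n.
  apply: leq_trans sumX _; apply: leq_trans (leq_add leA (leqnn _)).
  apply: (@leq_trans (\sum_(w in Row S k) ((#|Z w| - #|U|) + l))).
    by apply: leq_sum => w _; move: (cZ w) cU; clear; lia.
  rewrite big_split /= leq_add2l sum_nat_const mulnC leq_mul2l.
  by rewrite Row_card ?orbT.
have A_gt0 : 0 < #|A| by move: cA big; clear; lia.
have [r cr] := fibre_pigeonhole rw A_gt0.
exists r, [set e in A | rw e == r].
have [u0 u0A] : exists u, u \in [set e in A | rw e == r].
  apply/card_gt0P; rewrite lt0n; apply: contraL A_gt0 => /eqP e0.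
  by rewrite -leqNgt; move: cr; rewrite e0 muln0.
have AP u : u \in A -> [/\ u \in S, rw u \notin U & exists w v z,
   [/\ w \in Row S k, v \in X, w \in W v &
   [/\ z \in cell k (cl w), cl u = cl w, u != w, ext (Row S k :\ v) z &
       ext (Col S (cl w) :\ w :\ u) z]]].
  move=> /setIdP[uS /andP[uU /existsP[w /andP[wR /and3P[/eqP uc uw]]]]].
  move=> /existsP[z /andP[/setIdP[zB /existsP[v /and3P[vX wW ez]]] eu]].
  by split=> //; exists w, v, z.
have AM u : u \in A -> rw u != k /\ freeable S (k |: U) (rw u) l.+1 u.
  move=> /AP[uS uU [w [v [z [wR vX wW [zB uc uw ez eu]]]]]].
  have [_ _ /(_ w wW)[S' [P [y [fr sh wR' wP]]]]] := hW v vX.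
  have [mS' cP eR eRr eC] := fr.
  have wk : rw w = k by move: wR; rewrite inE => /andP[_ /eqP].
  have uC : u \in Col S' (cl w) by rewrite eC // inE uS uc eqxx.
  have mv : movable S' y w z u.
    have fS' := freeing_free vS (subsetP sX v vX) fr.
    apply: (shift_movable mS' fS' wR' sh zB) => //; first by rewrite eR.
    by rewrite eC.
  have [_ [_ _ _ _ nu] _ _] := mv; rewrite wk in nu.
  have [_ _ yv _] := sh.
  (* One more transfer, in the array that frees [v], frees [u]; it modifies two further columns,
     those of [v] and [w]. *)
  split=> //; exists (transfer S' y w z u), (cl v |: (cl w |: P)); split.
  - by case: (transfer_maxvol mv mS').
  - rewrite !cardsU1 doubleS; move: cP; clear.
    by case: (_ \notin _); case: (_ \notin _); lia.
  - by rewrite (transfer_Row mv) ?wk // eRr.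
  - move=> i; rewrite in_setU1 negb_or => /andP[ik iU] iu.
    by rewrite (transfer_Row_neq mv) ?wk // eRr.
  move=> j; rewrite !in_setU1 !negb_or => /and3P[jv jw jP].
  by rewrite (transfer_Col mv) ?yv // eC.
have /setIdP[u0A' /eqP ru0] := u0A.
split.
- have [uk _] := AM u0 u0A'; have [_ uU _] := AP u0 u0A'.
  by rewrite in_setU1 negb_or -ru0 uk.
- by apply/subsetP => u /setIdP[/AP[uS _ _] ur]; rewrite inE uS.
- exact: leq_trans cA (leq_add cr (leqnn _)).
by move=> u /setIdP[/AM[_ ?] /eqP <-].
Qed.

(** * Cascades *)

Variable c : nat.
Hypothesis c_gt0 : 0 < c.
Hypothesis gap : c * f + n <= c * (n - f).

Lemma double_f_le : f.*2 <= n.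
Proof. exact: double_le_of_gap c_gt0 gap. Qed.

Hypothesis n_big : 16 * c <= n.

(** Otherwise [cascade_step] could be repeated until the claimable part of a single row had more
    than [n] entries. *)
Lemma cascade S U k X :
  valid S -> k \notin U -> #|U| <= 1 -> X \subset Row S k ->
  {in X, forall v, freeable S U k 1 v} -> #|X| < 16 * c * c.
Proof.
move=> vS kU cU sX frX; rewrite ltnNge; apply/negP => bigX.
have f_gt0 : 0 < f by apply/card_gt0P; exists k.
have chain l : 8 * c * l.+1 <= n -> exists U k X,
    [/\ k \notin U, #|U| <= l.+1, X \subset Row S k,
        {in X, forall v, freeable S U k l.+1 v} &
        16 * c * c + 16 * c * l <= #|X|].
  elim: l => [|l IHl] l_n.
    by exists U, k, X; split=> //; rewrite muln0 addn0.
  have [|U1 [k1 [X1 [k1U cU1 sX1 frX1 bigX1]]]] := IHl.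
    by apply: leq_trans l_n; rewrite leq_mul2l leqnSn orbT.
  have b1 : 16 * c * c <= #|X1| by apply: leq_trans bigX1; exact: leq_addr.
  have b2 : 16 * c * l.+1 <= #|X1| by move: bigX1 c_gt0; clear; nia.
  have b3 : 8 * c * l.+1 <= n by move: l_n; clear; nia.
  have [lt1 _] := cascade_growth 0 c_gt0 gap f_gt0 b1 b2 b3.
  have [r [X2 [rU sX2 leX2 frX2]]] := cascade_step vS k1U cU1 sX1 frX1 lt1.
  have [_ /(_ leX2) b4] := cascade_growth #|X2| c_gt0 gap f_gt0 b1 b2 b3.
  exists (k1 |: U1), r, X2; split=> //.
    by rewrite cardsU1 k1U.
  by move: b4 bigX1; clear; nia.
have c8 : 0 < 8 * c by rewrite muln_gt0.
set l := n %/ (8 * c).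
have ln : 8 * c * l <= n by rewrite mulnC; exact: leq_divM.
have nl : n < l.+1 * (8 * c) by rewrite -ltn_divLR.
have l_gt0 : 0 < l by rewrite divn_gt0 //; move: n_big; clear; lia.
have [|U1 [k1 [X1 [_ _ sX1 _ bigX1]]]] := chain l.-1; first by rewrite prednK.
have := leq_trans (subset_leq_card sX1) (Row_card k1 vS).
(* As [l >= 1], we have [16 c l >= 8 c (l + 1) > n], too many for a row. *)
have : 16 * c * c + 16 * c * l.-1 >= 16 * c * l.
  by rewrite -{2}(prednK l_gt0); move: c_gt0; clear; nia.
by move: bigX1 nl n_big; clear; nia.
Qed.

(** Each possible shift [w] accepts at least as many elements as the deficit of row [k], and
    [spread] counts the entries they can displace. The columns [P] are avoided so that donations to
    several rows do not interfere. *)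
Lemma donors S k p P :
  maxvol S -> free S k p ->
  exists A : {set E}, [/\ A \subset S,
    (n - #|Row S k|) * (n - f - #|P|) <= #|A| &
    {in A, forall v, exists y w z,
       [/\ movable S y w z v, rw w = k, cl y = p & cl w \notin P]}].
Proof.
move=> mS fS; have vS := mS.1.
have [W [sW cW hW]] := shiftable_many mS fS.
have cD := card_avoid_cols P vS sW; set D := W :\: _ in cD.
have sD : D \subset Row S k by apply: subset_trans sW; exact: subsetDl.
pose Z w := [set z in cell k (cl w) | ext (Row S k) z].
have iZ : {in D, forall w, indep (Z w)}.
  move=> w _; apply: indepS (cell_indep k (cl w)) => //.
  by apply/subsetP => z; rewrite inE => /andP[].
have nZ : {in D, forall w, {in Z w, forall z, ~~ ext (Col S (cl w) :\ w) z}}.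
  move=> w /setDP[wW _] z /setIdP[zB ez]; have [y sh] := hW w wW.
  exact: shift_blocked mS fS (subsetP sW w wW) sh zB ez.
have := spread set0 vS sD iZ nZ; set A := [set u in S | _] => leA.
exists A; split; first by apply/subsetP => u /setIdP[].
  apply: leq_trans leA.
  apply: (@leq_trans (\sum_(w in D) (n - #|Row S k|))).
    rewrite sum_nat_const mulnC leq_mul2r; apply/orP; right.
    by move: cD cW; clear; lia.
  apply: leq_sum => w _; rewrite cards0 subn0 -(cell_card k (cl w)).
  exact: (card_ext matroidE (valid_indep_Row k vS)).
move=> v /setIdP[vvS /andP[_ /existsP[w /andP[wD /and3P[/eqP vc vw]]]]].
move=> /existsP[z /andP[/setIdP[zB ez] ev]].
have /setDP[wW wP] := wD; have [y sh] := hW w wW.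
exists y, w, z; have [_ _ yp _] := sh; split=> //.
- apply: (shift_movable mS fS (subsetP sW w wW) sh zB ez) => //.
  by rewrite inE vvS vc eqxx.
- by have := subsetP sD w wD; rewrite inE => /andP[_ /eqP].
by rewrite inE in wP.
Qed.

(** A donor in row [T] is freed by a single transfer through row [k], which alters two columns, so
    [cascade] applies with [U] reduced to [k]. *)
Lemma few_donors S k p P (A : {set E}) T :
  maxvol S -> A \subset S ->
  {in A, forall v, exists y w z,
     [/\ movable S y w z v, rw w = k, cl y = p & cl w \notin P]} ->
  #|Row A T| < 16 * c * c.
Proof.
move=> mS sA hA; case: (eqVneq T k) => [->|Tk].
  suff -> : Row A k = set0 by rewrite cards0 !muln_gt0 c_gt0.
  apply/setP => v; rewrite !inE; apply/negP => /andP[vA /eqP vk].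
  have [y [w [z [mv wk _ _]]]] := hA v vA.
  by case: mv => _ [_ _ _ _]; rewrite vk wk eqxx.
apply: (@cascade S [set k] T) => //; first by case: mS.
- by rewrite inE.
- by rewrite cards1.
- by apply/subsetP => v; rewrite !inE => /andP[/(subsetP sA)-> ->].
move=> v; rewrite inE => /andP[vA /eqP vT].
have [y [w [z [mv wk yp _]]]] := hA v vA.
exists (transfer S y w z v), [set cl y; cl w]; split.
- by case: (transfer_maxvol mv mS).
- by rewrite cards2; case: (_ != _).
- by rewrite (transfer_Row mv) ?wk.
- move=> r; rewrite inE => rk rT.
  by rewrite (transfer_Row_neq mv) ?wk ?vT.
move=> j; rewrite !inE negb_or => /andP[jy jw].
exact: (transfer_Col mv).
Qed.

Lemma free_exists S k : valid S -> #|Row S k| < n -> exists p, free S k p.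
Proof.
move=> vS cR; have : ~~ [forall j, j \in cl @: Row S k].
  apply: contraL cR => /forallP allj; rewrite -leqNgt.
  rewrite -(card_in_imset (cl_inj_Row (k := k) vS)).
  by apply: subset_leq_card; apply/subsetP => j _; apply: allj.
rewrite negb_forall => /existsP[p pR]; exists p => e eS ek ep.
by case/negP: pR; apply/imsetP; exists e => //; rewrite inE eS ek eqxx.
Qed.

(** A deficit of [16 c^2] would yield at least [16 c^2 f] donors, as [n - f >= f], while each of the
    [f] rows holds fewer than [16 c^2]. *)
Lemma deficit_bounded S k : maxvol S -> n - #|Row S k| < 16 * c * c.
Proof.
move=> mS; rewrite ltnNge; apply/negP => bigd.
have f_gt0 : 0 < f by apply/card_gt0P; exists k.
have c2 : 0 < 16 * c * c by rewrite !muln_gt0 c_gt0.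
have [|p fS] := @free_exists S k mS.1; first by move: bigd c2; clear; lia.
have [A [sA cA hA]] := donors set0 mS fS.
have : #|A| <= f * (16 * c * c).-1.
  rewrite -(sum_card_fibres rw A) -sum_nat_const; apply: leq_sum => T _.
  by have := few_donors T mS sA hA; rewrite /Row; move: c2; clear; lia.
move: cA; rewrite cards0 subn0 => cA.
have h : 16 * c * c * f <= #|A|.
  apply: leq_trans cA; apply: leq_mul => //.
  by move: double_f_le; clear; lia.
have h2 : f * (16 * c * c).-1 < 16 * c * c * f.
  by rewrite mulnC ltn_pmul2r // prednK.
by move: h h2; clear; lia.
Qed.

(** * Concentrating the deficits *)

(** The holes are moved one row at a time by shifts, which preserve row sizes; each shift has at
    least [n - f] target columns, more than are already taken. *)
Lemma distinct_free_columns S (K : {set I}) :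
  maxvol S -> #|K| < n - f -> {in K, forall k, #|Row S k| < n} ->
  exists S' (p : I -> J), [/\ maxvol S', forall i, #|Row S' i| = #|Row S i|,
    {in K, forall k, free S' k (p k)} & {in K &, injective p}].
Proof.
move=> mS; move Dm: #|K| => m.
elim: m K Dm => [|m IHm] K Dm cK defK.
  have/eqP K0 : #|K| == 0 by rewrite Dm.
  have J_gt0 : 0 < n by move: cK; clear; lia.
  have [j _] := card_gt0P J_gt0.
  exists S, (fun=> j); rewrite (cards0_eq K0).
  by split=> // [k|k k']; rewrite inE.
have [k kK] : exists k, k \in K by apply/card_gt0P; rewrite Dm.
have [|||S1 [p [mS1 cR fS1 injp]]] := IHm (K :\ k).
- by move: (cardsD1 k K); rewrite kK Dm; clear; lia.
- by move: cK; clear; lia.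
- by move=> i /setD1P[_]; apply: defK.
have vS1 := mS1.1.
have [|q fq] := @free_exists S1 k vS1; first by rewrite cR defK.
have [W [sW cW hW]] := shiftable_many mS1 fq.
have := card_avoid_cols (p @: (K :\ k)) vS1 sW; set D := W :\: _ => cD.
have : 0 < #|D|.
  have := leq_imset_card p (K :\ k).
  by move: cD cW cK (cardsD1 k K); rewrite kK Dm; clear; lia.
case/card_gt0P => w /setDP[wW]; rewrite inE => wp.
have [y sh] := hW w wW; have wR := subsetP sW w wW.
have [mS2 _] := shift_maxvol mS1 fq wR sh.
have [yG yk yq [_ /andP[yR _] _]] := sh.
move: (wR); rewrite inE => /andP[wS /eqP wk].
have wq : cl w != q by apply/eqP; apply: fq.
exists (y |: (S1 :\ w)), (fun i => if i == k then cl w else p i); split=> //.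
- move=> i; case: (eqVneq i k) => [->|ik].
    rewrite -{1}yk RowU1 RowD1 yk cardsU1 yR -cR.
    by rewrite [in RHS](cardsD1 w) wR.
  by rewrite RowU1_neq ?yk // RowD1_neq ?wk.
- move=> i iK; case: (eqVneq i k) => [->|ik].
    move=> e; rewrite in_setU1 => /orP[/eqP->|/setD1P[ew eS]] ek.
      by rewrite yq => /eqP; rewrite eq_sym (negPf wq).
    case/validP: vS1 => _ _ _ uS ec; case/eqP: ew; apply: uS => //.
    by rewrite ek wk.
  move=> e; rewrite in_setU1 => /orP[/eqP->|/setD1P[ew eS]] ei.
    by case/eqP: ik; rewrite -ei.
  by apply: fS1 ei => //; rewrite in_setD1 ik.
move=> i i' iK i'K; case: (eqVneq i k) => [->|ik]; case: (eqVneq i' k) => [->|ik'] //.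
- by move=> wpi; case/imsetP: wp; exists i'; rewrite // in_setD1 ik'.
- by move=> wpi; case/imsetP: wp; exists i; rewrite // in_setD1 ik.
by apply: injp; rewrite in_setD1 ?ik ?ik'.
Qed.

(** * Several donations by a single row *)

Section Donation.

Variables (S : {set E}) (K : {set I}) (p : I -> J) (T : I) (d : nat).
Variable A : I -> {set E}.
Hypothesis mS : maxvol S.
Hypothesis injp : {in K &, injective p}.
Hypothesis movA : {in K, forall k, {in A k, forall v, exists y w z,
  [/\ movable S y w z v, rw w = k, cl y = p k & cl w \notin p @: K]}}.
Hypothesis sA : {in K, forall k, A k \subset S}.
Hypothesis manyA : d * (#|K| + 16 * c * c) < \sum_(k in K) #|Row (A k) T|.

(** Lines not yet involved agree with [S], so transfers prepared in [S] stay usable; [V] avoids the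
    columns [p @: K] so that it cannot disturb the hole column of a later recipient. *)
Definition donated S' (K' : {set I}) (V : {set E}) :=
  [/\ [/\ maxvol S', K' \subset K, T \notin K', V \subset Row S T &
        {in V, forall v, cl v \notin p @: K}],
      Row S' T = Row S T :\: V,
      (forall i, i \notin K' -> i != T -> Row S' i = Row S i),
      {in K', forall i, #|Row S' i| = #|Row S i|.+1} &
      (forall j, j \notin p @: K' -> j \notin cl @: V -> Col S' j = Col S j)].

Lemma donation_step S' K' V :
  donated S' K' V -> #|K'| = #|V| -> #|V| <= d ->
  exists S2 k v, [/\ k \notin K', v \notin V & donated S2 (k |: K') (v |: V)].
Proof.
move=> [[mS' sK TK sV colV] eT eR cR eC] cKV cV.
have [k [v [kK kK' vA vV]]] : exists k v,
    [/\ k \in K, k \notin K', v \in Row (A k) T & v \notin V].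
  case: (boolP [exists k in K :\: K', exists v in Row (A k) T, v \notin V]).
    case/existsP=> k /andP[/setDP[kK kK'] /existsP[v /andP[vA vV]]].
    by exists k, v.
  rewrite negb_exists => /forallP noK; exfalso.
  move: manyA; rewrite ltnNge => /negP; apply.
  (* A row outside [K'] would claim only cells of [V], at most [d]; each of the at most [d] rows of
     [K'] claims fewer than [16 c^2]. *)
  apply: (@leq_trans (\sum_(k in K) (d + (k \in K') * (16 * c * c)))).
    apply: leq_sum => k kK; case: (boolP (k \in K')) => [kK'|kK'].
      rewrite mul1n; apply: leq_trans (leq_addl _ _); apply: ltnW.
      exact: few_donors mS (sA kK) (movA kK).
    rewrite mul0n addn0; apply: leq_trans cV; apply: subset_leq_card.
    apply/subsetP => v vA; have := noK k.
    rewrite in_setD kK kK' /= negb_exists => /forallP/(_ v).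
    by rewrite vA negbK.
  rewrite big_split /= sum_nat_const mulnDr mulnC leq_add2l -big_distrl /=.
  rewrite leq_mul2r; apply/orP; right.
  rewrite -big_mkcondr /= sum1_card; apply: leq_trans cV; rewrite -cKV.
  by apply: subset_leq_card; apply/subsetP => i; rewrite unfold_in => /andP[].
move: vA; rewrite inE => /andP[vA /eqP vT].
have [y [w [z [mv wk yp wp]]]] := movA kK vA.
have [[_ _ wS vS] [_ _ _ cvw nvw] _ _] := mv.
have kT : k != T by rewrite -vT -wk eq_sym.
have vR : v \in Row S T by rewrite inE vS vT eqxx.
have pkK : p k \in p @: K by apply/imsetP; exists k.
have pkK' : p k \notin p @: K'.
  apply: contra kK' => /imsetP[i iK' e].
  by rewrite (injp kK (subsetP sK i iK') e).
have wV : cl w \notin cl @: V.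
  rewrite -cvw; apply: contra vV => /imsetP[u uV e].
  by rewrite (cl_inj_Row mS.1 vR (subsetP sV u uV) e).
have wK' : cl w \notin p @: K'.
  by apply: contra wp; apply: (subsetP (imsetS p sK)).
(* Row [k] and the columns [p k] and [cl w] are still untouched. *)
have mv' : movable S' y w z v.
  apply: movable_local mv; rewrite ?wk ?yp.
  - by rewrite eR.
  - rewrite eC //; apply: contraL pkK => /imsetP[u uV ->]; exact: colV.
  by rewrite eC.
exists (transfer S' y w z v), k, v; split=> //; split; first split.
- by case: (transfer_maxvol mv' mS').
- by rewrite subUset sub1set kK.
- by rewrite in_setU1 negb_or eq_sym kT.
- by rewrite subUset sub1set vR.
- by move=> u; rewrite in_setU1 => /orP[/eqP->|/colV//]; rewrite cvw.
- rewrite (transfer_Row mv') ?wk 1?eq_sym // eT.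
  by apply/setP => u; rewrite !inE negb_or andbA.
- move=> i; rewrite in_setU1 negb_or => /andP[ik iK'] iT.
  by rewrite (transfer_Row_neq mv') ?wk ?vT // eR.
- move=> i; rewrite in_setU1; case: (eqVneq i k) => [-> _|ik /= iK'].
    by rewrite -wk (transfer_Row_card mv') wk eR.
  rewrite (transfer_Row_neq mv') ?wk ?vT //; first exact: cR.
  by apply: contraNneq TK => <-.
move=> j; rewrite !imsetU1 !in_setU1 !negb_or => /andP[jp jK] /andP[jv jV].
by rewrite (transfer_Col mv') ?yp -?cvw // eC.
Qed.

Lemma donation r : r <= d.+1 ->
  exists S' K' V, [/\ donated S' K' V, #|K'| = r & #|V| = r].
Proof.
elim: r => [|r IHr] rd.
  exists S, set0, set0; rewrite !cards0; split=> //; split=> //.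
  - by split; rewrite ?sub0set ?inE // => v; rewrite inE.
  - by rewrite setD0.
  by move=> i; rewrite inE.
have [S' [K' [V [dS cK cV]]]] := IHr (ltnW rd).
have [||S2 [k [v [kK vV dS2]]]] := donation_step dS; rewrite ?cK ?cV //.
by exists S2, (k |: K'), (v |: V); rewrite !cardsU1 kK vV cK cV.
Qed.

End Donation.

(* The weight makes one row of deficit [d + 1] outweigh [d + 1] rows of
   deficit [d]. *)
Definition potential S := \sum_i n.+2 ^ (n - #|Row S i|).

(** Only [T] and the rows of [K'] matter. The term of [T] is multiplied by [N^(d+1) >= (d + 2) N^d],
    which outweighs the [d + 1] lost terms [N^d]. *)
Lemma donated_potential S (K : {set I}) (p : I -> J) T d S' K' V :
  maxvol S -> 0 < d -> {in K, forall k, #|Row S k| + d = n} ->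
  donated S K p T S' K' V -> #|K'| = d.+1 -> #|V| = d.+1 ->
  potential S < potential S'.
Proof.
move=> mS d_gt0 cK [[mS' sK TK sV _] eT eR cR _] cK' cV.
rewrite /potential (bigD1 T) //= [ltnRHS](bigD1 T) //=.
rewrite (bigID (mem K')) /= [X in _ < _ + X](bigID (mem K')) /=.
set N := n.+2.
have -> : \sum_(i | (i != T) && (i \notin K')) N ^ (n - #|Row S' i|) =
          \sum_(i | (i != T) && (i \notin K')) N ^ (n - #|Row S i|).
  by apply: eq_bigr => i /andP[iT iK]; rewrite eR.
rewrite !addnA ltn_add2r.
have -> : \sum_(i | (i != T) && (i \in K')) N ^ (n - #|Row S i|) = d.+1 * N ^ d.
  rewrite -cK' -sum_nat_const; apply: eq_big => [i|i /andP[_ iK]].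
    by case: (eqVneq i T) => // ->; rewrite (negPf TK).
  by rewrite -(cK i (subsetP sK i iK)) addKn.
have cT : n - #|Row S' T| = (n - #|Row S T|) + d.+1.
  rewrite eT; have := cardsID V (Row S T); rewrite (setIidPr sV) cV.
  by have := Row_card T mS.1; clear; lia.
rewrite cT expnD; apply: ltn_addr.
have [k kK] : exists k, k \in K'.
  by apply/card_gt0P; rewrite cK'.
have dn : d <= n by rewrite -(cK k (subsetP sK k kK)) leq_addl.
have a_gt0 : 0 < N ^ (n - #|Row S T|) by rewrite expn_gt0.
have b_gt1 : 1 < N ^ d by rewrite -{1}(expn0 N) ltn_exp2l.
have h : d.+2 * N ^ d <= N ^ d.+1 by rewrite expnS leq_mul2r !ltnS dn orbT.
move: a_gt0 b_gt1 h; move: (N ^ _) (N ^ d) (N ^ d.+1) => a b b'; clear.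
move=> a_gt0 b_gt1 h; apply: (@leq_trans (a * (d.+2 * b))); first by nia.
by rewrite leq_mul2l h orbT.
Qed.

(** This is [c] times the bound on the deficits, the ratio that [donation_count] asks for. *)
Let m := c * (16 * c * c).

Hypothesis n_big' : 2 * c * m < n.

(** Given [m] rows of deficit [d] with holes moved to distinct columns, some row could donate to
    [d + 1] of them, which would raise the potential. *)
Lemma exact_deficit_few S d :
  maxvol S -> (forall S', maxvol S' -> potential S' <= potential S) -> 0 < d ->
  #|[set k | #|Row S k| + d == n]| < m.
Proof.
move=> mS maxP d_gt0; rewrite ltnNge; apply/negP => /card_geqP[s [us cs sK]].
pose K := [set k in s].
have cK : #|K| = m by rewrite cardsE; move/card_uniqP: us => ->.
have m_gt0 : 0 < m by rewrite !muln_gt0 c_gt0.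
have m_lt : m < n - f.
  by move: n_big' double_f_le c_gt0; clear; nia.
have defK k : k \in K -> #|Row S k| + d = n.
  by rewrite inE => /sK; rewrite inE => /eqP.
have [|k /defK|S1 [p [mS1 cR fS1 injp]]] := distinct_free_columns (K := K) mS.
- by rewrite cK.
- by move: d_gt0; clear; lia.
have defK1 : {in K, forall k, #|Row S1 k| + d = n}.
  by move=> k kK; rewrite cR defK.
have ex_A k : exists A : {set E}, k \in K ->
    [/\ A \subset S1, d * (n - f - m) <= #|A| &
    {in A, forall v, exists y w z,
       [/\ movable S1 y w z v, rw w = k, cl y = p k & cl w \notin p @: K]}].
  case: (boolP (k \in K)) => [kK|_]; last by exists set0.
  have [A [sA cA hA]] := donors (p @: K) mS1 (fS1 k kK).
  exists A => _; split=> //; apply: leq_trans cA; apply: leq_mul.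
    by rewrite -(defK1 k kK) addKn.
  by have := leq_imset_card p K; rewrite cK; clear; lia.
have [A hA] := fin_all_exists ex_A.
have movA : {in K, forall k, {in A k, forall v, exists y w z,
  [/\ movable S1 y w z v, rw w = k, cl y = p k & cl w \notin p @: K]}}.
  by move=> k /hA[].
have sA : {in K, forall k, A k \subset S1} by move=> k /hA[].
have [T manyT] : exists T,
    d * (#|K| + 16 * c * c) < \sum_(k in K) #|Row (A k) T|.
  case: (boolP [exists T, d * (#|K| + 16 * c * c) <
                          \sum_(k in K) #|Row (A k) T|]) => [/existsP//|].
  rewrite negb_exists => /forallP noT; exfalso.
  have le1 : \sum_(k in K) #|A k| <= f * (d * (m + 16 * c * c)).
    under eq_bigr => k _ do rewrite -(sum_card_fibres rw (A k)).
    rewrite exchange_big /= -sum_nat_const; apply: leq_sum => T _.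
    by have := noT T; rewrite -leqNgt cK.
  have le2 : m * (d * (n - f - m)) <= \sum_(k in K) #|A k|.
    by rewrite -cK -sum_nat_const; apply: leq_sum => k /hA[]; rewrite cK.
  have := leq_trans le2 le1; rewrite mulnCA [leqRHS]mulnCA leq_pmul2l //.
  apply/negP; rewrite -ltnNge.
  exact: (donation_count m_gt0 gap c_gt0 (erefl m) n_big').
have [S2 [K' [V [dS2 cK' cV]]]] := donation mS1 injp movA sA manyT (leqnn _).
have := donated_potential mS1 d_gt0 defK1 dS2 cK' cV.
have -> : potential S1 = potential S by apply: eq_bigr => i _; rewrite cR.
by rewrite ltnNge maxP //; case: dS2 => [[]].
Qed.

(** Among the arrays of maximum volume one of maximum potential is taken: its positive deficits are
    below [16 c^2], and each value occurs in fewer than [m] rows. *)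
Lemma full_rows : exists S, valid S /\
  #|[set k | #|Row S k| < n]| <= 16 * c * c * m.
Proof.
have v0 : valid set0.
  have [i0 _ _] := matroidE.
  apply/validP; split=> [|i|j|e]; rewrite ?sub0set ?inE //.
  - by have -> : Row set0 i = set0 by apply/setP => e; rewrite !inE.
  - by have -> : Col set0 j = set0 by apply/setP => e; rewrite !inE.
case: (arg_maxnP (fun S => #|S|) v0) => S0 vS0 maxS0.
pose mx S := valid S && (#|S| == #|S0|).
have mx0 : mx S0 by rewrite /mx vS0 eqxx.
have mxP S : reflect (maxvol S) (mx S).
  apply: (iffP andP) => [[vS /eqP cS]|[vS maxS]].
    by split=> // S' vS'; rewrite cS; apply: maxS0.
  by split=> //; rewrite eqn_leq maxS // andbT; apply: maxS0.
case: (arg_maxnP potential mx0) => S /mxP mS maxP.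
exists S; split; first by case: mS.
set F := [set k | _]; set D := 16 * c * c.
have D_gt0 : 0 < D by rewrite !muln_gt0 c_gt0.
(* Rows are sorted by deficit, which is below [D] by [deficit_bounded]; [D.-1.+1] is [D] in the
   successor form of [inord]. *)
rewrite -(sum_card_fibres (fun k => inord (n - #|Row S k|) : 'I_D.-1.+1) F).
apply: (@leq_trans (\sum_(d < D.-1.+1) m)); last first.
  by rewrite sum_nat_const card_ord prednK.
apply: leq_sum => d _; case: (posnP d) => [d0|d_gt0].
  rewrite (_ : [set _ in _ | _] = set0) ?cards0 //.
  apply/setP => k; rewrite [RHS]inE; apply/negP => /setIdP[].
  rewrite inE => kF /eqP/(congr1 val) /=; rewrite inordK; last first.
    by rewrite prednK //; exact: deficit_bounded.
  rewrite d0 => /eqP; rewrite subn_eq0 leqNgt.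
  by rewrite kF.
apply: ltnW; apply: leq_ltn_trans (exact_deficit_few mS _ d_gt0); last first.
  by move=> S' /mxP; apply: maxP.
apply: subset_leq_card; apply/subsetP => k /setIdP[].
rewrite !inE => kF /eqP <-; rewrite inordK; last first.
  by rewrite prednK //; exact: deficit_bounded.
by rewrite subnKC // ltnW.
Qed.

End Array.

(** * From cells to representatives *)

Section Bases.

Variables (T : finType) (indep : {set T} -> bool).
Hypothesis matroidT : is_matroid indep.

Lemma indep_card_le_mrank A : indep A -> #|A| <= mrank indep.
Proof. exact: (@leq_bigmax_cond _ indep (fun A => #|A|)). Qed.

Lemma basis_card A : is_basis indep A -> #|A| = mrank indep.
Proof.
move=> [iA maxA]; apply/eqP; rewrite eqn_leq indep_card_le_mrank //=.
apply/bigmax_leqP => C iC; apply: (spanned_card matroidT) => // z _.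
apply/negP => /andP[zA izA]; case/negP: zA.
by rewrite -(maxA _ (subsetUr _ _) izA) setU11.
Qed.

Lemma basis_of_card A : indep A -> #|A| = mrank indep -> is_basis indep A.
Proof.
move=> iA cA; split=> // C sAC iC; apply/esym/eqP.
by rewrite eqEcard sAC cA indep_card_le_mrank.
Qed.

End Bases.

Section ParallelExtension.

Variables (T E : finType) (indep : {set T} -> bool) (h : E -> T).
Hypothesis matroidT : is_matroid indep.

(** Independence when each point of [T] is replaced by parallel copies, namely its fibre under
    [h]. *)
Definition pindep (A : {set E}) := (#|h @: A| == #|A|) && indep (h @: A).

Lemma pindep_inj (A : {set E}) :
  {in A &, injective h} -> indep (h @: A) -> pindep A.
Proof. by move=> injA iA; rewrite /pindep iA card_in_imset // eqxx. Qed.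

Lemma pindep_matroid : is_matroid pindep.
Proof.
have [i0 isub iexch] := matroidT; split.
- by rewrite /pindep imset0 !cards0 eqxx.
- move=> A B sBA /andP[/imset_injP injA iA]; apply: pindep_inj.
    by move=> e e' /(subsetP sBA) eA /(subsetP sBA) e'A; apply: injA.
  by apply: isub iA; exact: imsetS.
move=> A B /andP[/eqP cA iA] /andP[/eqP cB iB]; rewrite -cA -cB => ltBA.
have [t] := iexch _ _ iA iB ltBA; rewrite inE => /andP[tB /imsetP[e eA te]] itB.
have eB : e \notin B by apply: contra tB => eB; rewrite te imset_f.
exists e; first by rewrite inE eB.
by rewrite /pindep imsetU1 -te !cardsU1 tB eB cB eqxx.
Qed.

End ParallelExtension.

(** An element of [E] is a representative tagged with its row and column, so one point may occur in
    many cells. The full rows form [L]; they project to independent sets of size [n], hence to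
    bases. *)
Lemma matroid_arrays (T : finType) (indep : {set T} -> bool) (c f n : nat)
    (B : 'I_f -> 'I_n -> {set T}) :
  is_matroid indep -> mrank indep = n -> (forall i j, is_basis indep (B i j)) ->
  0 < c -> c * f + n <= c * (n - f) -> 16 * c <= n ->
  2 * c * (c * (16 * c * c)) < n ->
  exists (L : {set 'I_f}) (b : 'I_f -> 'I_n -> T),
    [/\ f <= #|L| + 16 * c * c * (c * (16 * c * c)),
        (forall i j, i \in L -> b i j \in B i j),
        (forall i, i \in L -> is_basis indep [set b i j | j : 'I_n]) &
        (forall j, indep [set b i j | i in L])].
Proof.
move=> matT rk basB c_gt0 gap nb1 nb2.
pose E := ('I_f * 'I_n * T)%type.
pose rw (e : E) := e.1.1; pose cl (e : E) := e.1.2; pose h (e : E) := e.2.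
pose G := [set e : E | h e \in B (rw e) (cl e)].
have eqE (e e' : E) : rw e = rw e' -> cl e = cl e' -> h e = h e' -> e = e'.
  by case: e e' => [[i j] t] [[i' j'] t']; rewrite /rw /cl /h /= => -> -> ->.
have matE := pindep_matroid h matT.
have injc i j : {in cell rw cl G i j &, injective h}.
  move=> e e'; rewrite !inE => /and3P[_ /eqP ei /eqP ej] /and3P[_ /eqP ei' /eqP ej'].
  by apply: eqE; rewrite ?ei ?ej.
have hc i j : h @: cell rw cl G i j = B i j.
  apply/setP => t; apply/imsetP/idP => [[e]|tB].
    by rewrite !inE => /and3P[eB /eqP <- /eqP <-] ->.
  by exists ((i, j), t); rewrite // !inE /rw /cl /h /= tB !eqxx.
have cell_indep i j : pindep indep h (cell rw cl G i j).
  by apply: pindep_inj => //; rewrite hc; case: (basB i j).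
have cell_card i j : #|cell rw cl G i j| = #|'I_n|.
  by rewrite -(card_in_imset (injc i j)) hc card_ord -rk; apply: basis_card.
have cf : #|'I_f| = f by rewrite card_ord.
have cn : #|'I_n| = n by rewrite card_ord.
have [|||S [vS few]] := full_rows matE cell_indep cell_card c_gt0; rewrite ?cf ?cn //.
case/validP: (vS) => sG iR iC uS.
pose L := [set i | #|Row rw S i| == n].
have [b hb] : exists b : 'I_f -> 'I_n -> T, forall i j,
    b i j \in B i j /\ (i \in L -> ((i, j), b i j) \in S).
  have ex_b (x : 'I_f * 'I_n) : exists t,
      t \in B x.1 x.2 /\ (x.1 \in L -> (x, t) \in S).
    case: x => i j /=; case: (boolP (i \in L)) => [|_].
      rewrite inE => /eqP cR.
      have : j \in cl @: Row rw S i.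
        have/eqP -> : cl @: Row rw S i == setT.
          rewrite eqEcard subsetT cardsT card_ord.
          by rewrite (card_in_imset (cl_inj_Row (k := i) vS)) cR leqnn.
        by rewrite inE.
      case/imsetP=> e; rewrite inE => /andP[eS /eqP ei] ej; exists (h e); split.
        by have := subsetP sG e eS; rewrite inE ei -ej.
      suff -> : (i, j, h e) = e by [].
      by apply: eqE; rewrite // /rw /cl /=.
    (* Outside [L] any representative serves; the basis is nonempty because the index [j] forces
       [n > 0]. *)
    have : 0 < #|B i j|.
      by rewrite (basis_card matT (basB i j)) rk; case: (j) => jj /=; lia.
    by case/card_gt0P => t tB; exists t.
  have [b hb] := fin_all_exists ex_b.
  by exists (fun i j => b (i, j)) => i j; apply: (hb (i, j)).
exists L, b; split.
- have := cardsID L [set: 'I_f]; rewrite setTI cardsT cf setTD.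
  have -> : ~: L = [set k | #|Row rw S k| < n].
    apply/setP => k; rewrite !inE ltn_neqAle; case: eqP => //= _.
    by have := Row_card k vS; rewrite cn => ->.
  by move: few; rewrite cn; move: (#|_|) (_ * _) (#|L|); clear; lia.
- by move=> i j _; case: (hb i j).
- move=> i iL; have -> : [set b i j | j : 'I_n] = h @: Row rw S i.
    apply/setP => t; apply/imsetP/imsetP => [[j _ ->]|[e]].
      exists (i, j, b i j) => //; rewrite inE /rw eqxx andbT.
      by have [_ ->] := hb i j.
    rewrite inE => /andP[eS /eqP ei] ->; exists (cl e) => //.
    have [_ /(_ iL) bS] := hb i (cl e).
    by rewrite (uS e _ eS bS).
  have /andP[/eqP cRh iRh] := iR i.
  apply: (basis_of_card iRh); rewrite cRh rk; apply/eqP.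
  by move: iL; rewrite inE.
move=> j; have /andP[_ iCh] := iC j; apply: indepS iCh => //.
apply/subsetP => t /imsetP[i iL ->]; apply/imsetP; exists (i, j, b i j) => //.
by rewrite inE /cl eqxx andbT; have [_ ->] := hb i j.
Qed.

(* Bounds for the real parameter *)
Local Delimit Scope R_scope with Re.

(** As [eps < 1] the floor is not negative, so [Z.to_nat] does not truncate. *)
Lemma fbound_bounds (eps : R) (n : nat) : (eps < 1)%Re ->
  (2 * INR (fbound eps n) <= (1 - eps) * INR n < 2 * INR (fbound eps n) + 2)%Re.
Proof.
move=> eps1; rewrite /fbound; set r := ((1 - eps) * INR n / 2)%Re.
have r_ge0 : (0 <= r)%Re by have := pos_INR n; rewrite /r; nra.
have [le_r lt_r] := base_Int_part r.
have z_ge0 : (0 <= Int_part r)%Z.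
  have : (-1 < Int_part r)%Z by apply: lt_IZR; lra.
  lia.
rewrite INR_IZR_INZ Znat.Z2Nat.id // -/r.
have -> : ((1 - eps) * INR n = 2 * r)%Re by rewrite /r; field.
by lra.
Qed.

Theorem theorem1p2 :
  forall eps : R, Rlt (IZR 0) eps ->
  exists n0 : nat, forall n : nat, n0 <= n ->
  forall (T : finType) (indep : {set T} -> bool),
    is_matroid indep -> mrank indep = n ->
    forall B : 'I_(fbound eps n) -> 'I_n -> {set T},
      (forall i j, is_basis indep (B i j)) ->
      exists (L : {set 'I_(fbound eps n)}) (b : 'I_(fbound eps n) -> 'I_n -> T),
        [/\ Rle (Rmult (Rminus (Rinv (IZR 2)) eps) (INR n)) (INR #|L|),
            (forall i j, i \in L -> b i j \in B i j),
            (forall i, i \in L -> is_basis indep [set b i j | j : 'I_n]) &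
            (forall j, indep [set b i j | i in L])].
Proof.
move=> eps eps_gt0.
case: (Rlt_le_dec eps 1) => [eps1|eps1]; last first.
  (* For [eps >= 1] there are no rows, and the required size of [L] is not positive. *)
  exists 0 => n _ T indep [i0 _ _] rk B basB.
  have noI (i : 'I_(fbound eps n)) : False.
    case: i => i; rewrite /fbound; set r := (_ / _)%Re.
    have r_le0 : (r <= 0)%Re by have := pos_INR n; rewrite /r; nra.
    have [le_r _] := base_Int_part r.
    have : (Int_part r <= 0)%Z by apply: le_IZR; lra.
    by case: (Int_part r).
  exists set0, (fun i => False_rect _ (noI i)); split.
  - by rewrite cards0 /=; have := pos_INR n; nra.
  - by move=> i.
  - by move=> i.
  by move=> j; rewrite imset0.
(* With [1 / c <= eps] the slack [eps n] becomes the integer gap. *)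
have [c [c_gt0 c_eps]] : exists c : nat, 0 < c /\ (1 <= INR c * eps)%Re.
  have [c Hc] := INR_unbounded (/ eps)%Re; exists c.
  have c1 : (1 <= INR c * eps)%Re.
    have -> : (1 = / eps * eps)%Re by field; lra.
    by apply: Rmult_le_compat_r; lra.
  split=> //; case: (posnP c) c1 => // ->; rewrite /=; lra.
(* [M] bounds the number of rows that are not full. *)
have [M defM] : exists M, M = 16 * c * c * (c * (16 * c * c)) by eexists.
(* The terms secure the two size conditions of [matroid_arrays], the second of them strict, and
   [M + 1 <= eps n / 2]. *)
exists (16 * c + 2 * c * (c * (16 * c * c)) + 2 * c * M.+1 + 1) => n n_big.
move=> T indep matT rk B basB.
have [le_f lt_f] := fbound_bounds n eps1.
set f := fbound eps n in B basB le_f lt_f *.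
have gap : c * f + n <= c * (n - f).
  have h : f.*2 * c + n <= c * n.
    apply/leP/INR_le; rewrite plus_INR !mult_INR -addnn plus_INR.
    have := pos_INR c; have := pos_INR n.
    nra.
  by move: h c_gt0; clear; nia.
have [||L [b [leL bB bR bC]]] := matroid_arrays matT rk basB c_gt0 gap.
- by move: n_big; clear; lia.
- by move: n_big; clear; lia.
exists L, b; split=> //.
have leL' : (INR f <= INR #|L| + INR M)%Re.
  by rewrite -plus_INR; apply: le_INR; apply/leP; rewrite defM.
have n_big' : (2 * INR c * (INR M + 1) <= INR n)%Re.
  have -> : (2 * INR c * (INR M + 1) = INR (2 * c * M.+1))%Re.
    by rewrite !mult_INR (S_INR M) (INR_IZR_INZ 2).
  by apply: le_INR; apply/leP; move: n_big; clear; lia.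
(* Of the permitted loss [eps n], one half is spent on the factor [1 - eps] in [f], the other on the
   [M] lost rows and the rounding of [f]. *)
have h : (INR M + 1 <= eps * INR n / 2)%Re.
  have := pos_INR M; nra.
lra.
Qed.
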